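(* Let $\mathbb{X}$ be a reflexive real Banach space, let $\bm\theta_0\in\mathbb X$, let $\mathbf u\in\mathbb X^*$ with $\|\mathbf u\|_{\mathbb X^*}<1$, and suppose that $Z_n\stackrel{p}{\to}\bm\theta_0$ as $n\to\infty$. Let $T_{\mathbf u,n,k_n}=\mathbf q_{\mathbf u}(\tilde Z^{(1)}_{\lfloor n/k_n\rfloor},\dots,\tilde Z^{(k_n)}_{\lfloor n/k_n\rfloor})$ be computed from the sample of size $n$ in which $l_n$ observations are contaminated. Then $T_{\mathbf u,n,k_n}\stackrel{p}{\to}\bm\theta_0$ as $n\to\infty$ for any $l_n$ and $k_n$ such that $k_n=o(n)$ and $\lim_{n\to\infty}\frac{l_n}{k_n}=0$.
   Context: Univariate quantile: for $\alpha\in(0,1)$ and $(x_1,\dots,x_k)\in\mathbb R^k$ with increasing rearrangement $\tilde x_1\le\dots\le\tilde x_k$, $q_\alpha(x_1,\dots,x_k)=\frac12(\tilde x_{\lceil k\alpha\rceil}+\tilde x_{\lfloor k\alpha+1\rfloor})$. Geometric quantile with parameter $\mathbf u$: a minimizer over $\mathbf y\in\mathbb X$ of $\sum_{i=1}^k\|\mathbf x_i-\mathbf y\|_{\mathbb X}+\langle\mathbf u,\mathbf x_i-\mathbf y\rangle$. The function $\mathbf q_{\mathbf u}:\mathbb X^k\to\mathbb X$ is defined as follows. Let $E_k=\{1-\frac{2j}{k}:j=1,\dots,\lfloor\frac k2\rfloor\}$. If $\|\mathbf u\|_{\mathbb X^*}\notin E_k$, or if $\mathbf x_1,\dots,\mathbf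 x_k$ do not lie on a straight line, $\mathbf q_{\mathbf u}(\mathbf x_1,\dots,\mathbf x_k)$ is the geometric quantile (any minimizer, should it not be unique). If $\|\mathbf u\|_{\mathbb X^*}\in E_k$ and $\mathbf x_1,\dots,\mathbf x_k$ lie on a straight line, write $\mathbf x_i=\mathbf z+x_i\mathbf h$ with $\mathbf z,\mathbf h\in\mathbb X$, $\|\mathbf h\|_{\mathbb X}=1$, $x_i\in\mathbb R$, set $\alpha=\frac{1+\langle\mathbf u,\mathbf h\rangle}{2}$, and $\mathbf q_{\mathbf u}(\mathbf x_1,\dots,\mathbf x_k)=\mathbf z+q_\alpha(x_1,\dots,x_k)\mathbf h$. Estimators and contamination: for each $m$, $Z_m$ is an $\mathbb X$-valued estimator of $\bm\theta_0$ obtained by applying a fixed map to $m$ i.i.d. (uncontaminated) observations; the convergence hypothesis concerns this uncontaminated estimator. In the sample of $n$ i.i.d. observations, $l_n$ observations are contaminated, i.e. replaced by arbitrary random variables (arbitrary distributions, arbitrary dependence among themselves and with the other observations, arbitrary positions). The resulting sample is divided into $k_n$ disjoint blocks of equal size $\lfloor n/k_n\rfloor$, and $\tilde Z^{(i)}_{\lfloor n/k_n\rfloor}$ is the estimator computed from block $i$ of the contaminated sample (if contamination makes it not uniquely defined, it may take any of the possible values). *)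

(* Defs.v *)
From HB Require Import structures.
From mathcomp Require Import all_boot all_order all_algebra.
From mathcomp Require Import all_classical all_reals all_analysis.

Set Implicit Arguments.
Unset Strict Implicit.
Unset Printing Implicit Defensive.

Import Order.TTheory GRing.Theory Num.Theory.
Import numFieldNormedType.Exports.

Local Open Scope classical_set_scope.
Local Open Scope ring_scope.

Section dual_space.
Context {R : realType} {X : normedModType R}.

Definition topological_dual : set (X -> R^o) :=
  [set f | linear f /\ continuous f].

Definition dual_norm (f : X -> R^o) : R :=
  sup [set `|f x| | x in [set x : X | `|x| <= 1]].

End dual_space.

(* [Phi] ranges over the bidual: only its values on [topological_dual] matter. *)
Definition reflexive_space {R : realType} (X : normedModType R) : Prop :=
  forall Phi : (X -> R^o) -> R,
    (forall (a : R) (f g : X -> R^o), topological_dual f ->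
       topological_dual g -> Phi (a *: f + g) = a * Phi f + Phi g) ->
    (exists C : R, forall f, topological_dual f ->
       `|Phi f| <= C * dual_norm f) ->
  exists x : X, forall f, topological_dual f -> Phi f = f x.

Section quantiles.
Context {R : realType}.

(* j-th smallest value, counted from j = 1 *)
Definition order_statistic k (x : 'I_k -> R) (j : nat) : R :=
  nth 0 (sort <=%R [seq x i | i <- enum 'I_k]) j.-1.

Definition univariate_quantile (alpha : R) k (x : 'I_k -> R) : R :=
  (order_statistic x `|Num.ceil (k%:R * alpha)|%N +
   order_statistic x `|Num.floor (k%:R * alpha + 1)|%N) / 2.

Definition exceptional_norms (k : nat) : set R :=
  [set r | exists2 j : nat, (1 <= j <= k./2)%N & r = 1 - (2 * j)%:R / k%:R].

Context {X : normedModType R}.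

Definition quantile_objective (u : X -> R^o) k (x : 'I_k -> X) (y : X) : R :=
  \sum_(i < k) (`|x i - y| + u (x i - y)).

Definition geometric_quantile (u : X -> R^o) k (x : 'I_k -> X) (y : X) : Prop :=
  forall y', quantile_objective u x y <= quantile_objective u x y'.

Definition line_coordinates k (x : 'I_k -> X) (z h : X) (t : 'I_k -> R) : Prop :=
  `|h| = 1 /\ forall i, x i = z + t i *: h.

Definition on_straight_line k (x : 'I_k -> X) : Prop :=
  exists z h t, line_coordinates x z h t.

(* [y] is an admissible value of q_u at [x].  In the second case [y] does not
   depend on the chosen coordinates: replacing [h] by [- h] turns [alpha] into
   [1 - alpha] and reverses the order of the coordinates. *)
Definition quantile_value (u : X -> R^o) k (x : 'I_k -> X) (y : X) : Prop :=
  let special := exceptional_norms k (dual_norm u) /\ on_straight_line x in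
  (~ special -> geometric_quantile u x y) /\
  (special -> exists z h t, line_coordinates x z h t /\
     y = z + univariate_quantile ((1 + u h) / 2) t *: h).

Definition quantile_map (u : X -> R^o) (q : forall k, ('I_k -> X) -> X) : Prop :=
  forall k (x : 'I_k -> X), (0 < k)%N -> quantile_value u x (q k x).

End quantiles.

Notation borel X := (g_sigma_algebraType (@open X)).

Section probability.
Context {d : measure_display} {Omega : measurableType d} {R : realType}.
Variable P : probability Omega R.

(* The outer measure [mu_ext P] agrees with [P] on measurable sets; it gives a
   meaning to convergence in probability of maps not known to be measurable. *)
Definition cvg_in_probability {X : normedModType R} (Z : nat -> Omega -> X)
    (theta : X) : Prop :=
  forall eps : R, 0 < eps ->
    mu_ext P [set w | eps < `|Z n w - theta|] @[n --> \oo] --> 0%E.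

Context {dE : measure_display} {E : measurableType dE}.

Definition iid_sample (D : probability E R) n (Y : Omega -> n.-tuple E) : Prop :=
  (forall (i : 'I_n) (A : set E), measurable A ->
     P [set w | A (tnth (Y w) i)] = D A) /\
  (forall (J : {set 'I_n}) (A : 'I_n -> set E), (forall i, measurable (A i)) ->
     P [set w | forall i, i \in J -> A i (tnth (Y w) i)] =
     (\prod_(i in J) P [set w | A i (tnth (Y w) i)])%E).

(* The contaminated positions may be random.  A replaced observation may
   happen to keep its value, so "at most l" is the same as "l". *)
Definition contaminated (l n : nat) (Y W : Omega -> n.-tuple E) : Prop :=
  exists S : Omega -> {set 'I_n}, forall w,
    (#|S w| <= l)%N /\
    forall i, i \notin S w -> tnth (W w) i = tnth (Y w) i.

End probability.

Definition disjoint_blocks (n k m : nat) (b : 'I_k -> 'I_m -> 'I_n) : Prop :=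
  injective (fun p : 'I_k * 'I_m => b p.1 p.2).

Definition subsample (T : Type) (n m : nat) (s : n.-tuple T)
  (b : 'I_m -> 'I_n) : m.-tuple T := [tuple tnth s (b j) | j < m].

(* Main.v *)
Require Import Defs.
From HB Require Import structures.
From mathcomp Require Import all_boot all_order all_algebra.
From mathcomp Require Import all_classical all_reals all_analysis.
From mathcomp Require Import measurable_realfun lra ring zify.

Set Implicit Arguments.
Unset Strict Implicit.
Unset Printing Implicit Defensive.

Import Order.TTheory GRing.Theory Num.Theory.
Import numFieldNormedType.Exports.

Local Open Scope classical_set_scope.
Local Open Scope ring_scope.

(** Write nu for the dual norm of u, so that nu < 1.

    Robustness.  If all but a set B of the k points lie within delta of theta,
    and the fraction of B is at most (1 - nu) / 4, then the quantile lies within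
    4 delta / (1 - nu) of theta, wherever the points of B are
    ([quantile_near]).  For a minimizer this comes from comparing the objective
    at y and at theta: each good point makes the difference grow by about
    |y - theta|, each bad point lowers it by at most |y - theta|, and the linear
    term costs at most nu |y - theta| per point.  For the univariate quantile on
    a line, both order statistics involved have more than #|B| points on either
    side, so they lie between two good coordinates.

    Probability.  A block is bad when it contains a replaced observation, or
    when the estimator computed from its original observations is far from
    theta0 or not unique.  The blocks being disjoint, at most l of them are of
    the first kind.  Blocks of an iid sample of size n have the law of an iid
    sample of size m = n %/ k, so each block is of the second kind with the
    probability p_m that the estimator from m clean observations is far from
    theta0, and by Markov's inequality at least a fraction c of them are with
    probability at most p_m / c.  This yields the non-asymptotic bound
    [quantile_deviation_le]; it remains to see that m tends to infinity because
    k = o(n), whence p_m tends to 0, and that l / k is eventually small. *)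

(** * Univariate quantiles *)

Section order_statistics.
Context {R : realType} (k : nat) (t : 'I_k -> R) (B : {set 'I_k}).

Lemma count_sort_le_card (p : pred R) : (forall i, p (t i) -> i \in B) ->
  (count p (sort <=%R [seq t i | i <- enum 'I_k]) <= #|B|)%N.
Proof.
move=> pB; rewrite count_sort count_map -size_filter cardE.
apply: uniq_leq_size; first by rewrite filter_uniq// enum_uniq.
by move=> i; rewrite mem_filter !mem_enum => /andP[/pB].
Qed.

Lemma order_statistic_ge (a : R) (j : nat) : (#|B| < j <= k)%N ->
  (forall i, i \notin B -> a <= t i) -> a <= order_statistic t j.
Proof.
move=> /andP[Bj jk] aB; apply: nth_count_ge.
  exact/sort_sorted/le_total.
rewrite size_sort size_map size_enum_ord; apply/andP; split; last lia.
rewrite (@leq_trans #|B|) ?count_sort_le_card//; last by lia.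
by move=> i /=; apply: contraTT => /aB; rewrite leNgt.
Qed.

Lemma order_statistic_le (c : R) (j : nat) : (0 < j)%N -> (#|B| + j <= k)%N ->
  (forall i, i \notin B -> t i <= c) -> order_statistic t j <= c.
Proof.
move=> j0 Bj Bc; apply: nth_count_le.
  exact/sort_sorted/le_total.
have := count_predC (<= c) (sort <=%R [seq t i | i <- enum 'I_k]).
rewrite size_sort size_map size_enum_ord.
have : (count (predC (<= c)) (sort <=%R [seq t i | i <- enum 'I_k]) <= #|B|)%N.
  by apply: count_sort_le_card => i /=; apply: contraR; exact: Bc.
lia.
Qed.

End order_statistics.

(** The ranks j that occur are in [k alpha, k alpha + 1], so that more than #|B|
    entries have rank at most j and more than #|B| have rank at least j; on either
    side one of them is outside B. *)
Lemma univariate_quantile_between (R : realType) (k : nat) (t : 'I_k -> R)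
    (B : {set 'I_k}) (alpha a c : R) :
  #|B|%:R < k%:R * alpha -> #|B|%:R < k%:R * (1 - alpha) ->
  (forall i, i \notin B -> a <= t i <= c) ->
  a <= univariate_quantile alpha t <= c.
Proof.
move=> Balpha Balpha' tB.
have b0 : 0 <= #|B|%:R :> R by [].
have between (j : int) : k%:R * alpha <= j%:~R -> j%:~R <= k%:R * alpha + 1 ->
    #|B|%:R + j%:~R < k%:R + 1 :> R ->
    a <= order_statistic t `|j|%N <= c.
  move=> jl ju Bjk.
  (* j is at least k * alpha > #|B| >= 0, so that its absolute value is j. *)
  have j0 : 0 <= j by rewrite -(ler_int R); lra.
  case: j j0 jl ju Bjk => // j _ jl ju Bjk; rewrite absz_nat.
  have Bj : (#|B| < j)%N by rewrite -(ltr_nat R); lra.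
  have {}Bjk : (#|B| + j <= k)%N.
    by rewrite -ltnS -(ltr_nat R) natrD -natr1.
  apply/andP; split.
    apply: (@order_statistic_ge _ _ _ B); last by move=> i /tB/andP[].
    by rewrite Bj (leq_trans (leq_addl _ _) Bjk).
  apply: (@order_statistic_le _ _ _ B) => //; last by move=> i /tB/andP[].
  exact: leq_ltn_trans Bj.
have ceil_lt := ceilB1_lt (k%:R * alpha); rewrite intrB in ceil_lt.
have floor_gt := floorD1_gt (k%:R * alpha + 1); rewrite intrD in floor_gt.
have ceil_gt := ceil_ge (k%:R * alpha).
have floor_lt := floor_le (k%:R * alpha + 1).
have /andP[ceil_ge_a ceil_le_c] :
    a <= order_statistic t `|Num.ceil (k%:R * alpha)|%N <= c.
  by apply: between => //; lra.
have /andP[floor_ge_a floor_le_c] :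
    a <= order_statistic t `|Num.floor (k%:R * alpha + 1)|%N <= c.
  by apply: between => //; lra.
rewrite /univariate_quantile; apply/andP; split; lra.
Qed.

(** * Robustness of the quantile in a normed space *)

(** Continuity is what makes the supremum in [dual_norm] that of a bounded set. *)
Lemma normr_le_dual_norm (R : realType) (X : normedModType R)
    (u : {linear X -> R^o}) (x : X) :
  continuous u -> `|u x| <= dual_norm u * `|x|.
Proof.
move=> /linear_bounded_continuous/bounded_funP/(_ 1)[M uM].
have [->|x0] := eqVneq x 0; first by rewrite linear0 !normr0 mulr0.
have nx0 : 0 < `|x| by rewrite normr_gt0.
rewrite -ler_pdivrMr//; apply: ub_le_sup.
  by exists M => _ /= [y y1 <-]; exact: uM.
exists (`|x|^-1 *: x) => /=.
  by rewrite normrZ ger0_norm ?invr_ge0// mulVf// gt_eqF.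
by rewrite linearZ /= normrZ ger0_norm ?invr_ge0 1?mulrC.
Qed.

(** Minimality of y is tested against theta only.  By the triangle inequality,
    moving from y to theta saves at least (1 - nu) |y - theta| - 2 delta at each
    good point and costs at most (1 + nu) |y - theta| at each bad one; bad points
    are too few to compensate when |y - theta| is large. *)
Lemma geometric_quantile_near (R : realType) (X : normedModType R)
    (u : {linear X -> R^o}) (k : nat) (x : 'I_k -> X) (theta y : X) (delta : R)
    (B : {set 'I_k}) :
  continuous u -> dual_norm u < 1 -> (0 < k)%N -> 0 <= delta ->
  4 * #|B|%:R <= (1 - dual_norm u) * k%:R ->
  (forall i, i \notin B -> `|x i - theta| <= delta) ->
  geometric_quantile u x y -> (1 - dual_norm u) * `|y - theta| <= 4 * delta.
Proof.
move=> u_continuous u_lt1 k_gt0 delta_ge0 B_small x_near.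
move=> /(_ theta); rewrite /quantile_objective -subr_ge0 -sumrB => ymin.
have r0 : 0 <= `|y - theta| by [].
have u_ge : - (dual_norm u * `|y - theta|) <= u (theta - y) :> R.
  have := normr_le_dual_norm (theta - y) u_continuous.
  by rewrite ler_norml distrC => /andP[].
(* The second summand corrects the bound for good points, which is too small by
   at most 2 |y - theta| at a bad one. *)
have term i : `|x i - theta| + u (x i - theta) - (`|x i - y| + u (x i - y)) <=
    (2 * delta - (1 - dual_norm u) * `|y - theta|) +
    (if i \in B then 2 * `|y - theta| else 0).
  have -> : u (x i - theta) = u (x i - y) - u (theta - y).
    by rewrite -linearB; congr (u _); rewrite opprB addrA subrK.
  case: ifPn => iB.
    by have := ler_distD y (x i) theta; lra.
  have := x_near i iB; have := ler_distD (x i) y theta.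
  by rewrite [`|y - x i|]distrC; lra.
have := le_trans ymin (ler_sum _ (fun i _ => term i)).
rewrite big_split /= sumr_const card_ord -big_mkcond /= sumr_const.
rewrite -[X in X + _]mulr_natr -[X in _ + X]mulr_natr => total.
have k0 : 0 < k%:R :> R by rewrite ltr0n.
have Br : 4 * #|B|%:R * `|y - theta| <= (1 - dual_norm u) * k%:R * `|y - theta|.
  exact: ler_wpM2r.
by rewrite -(ler_pM2r k0); lra.
Qed.

(** On an exceptional line theta may lie off the line, so the coordinates are
    compared with that of a good point x g: the other good ones are within
    2 delta of it, hence so is the quantile, and theta is within delta of x g.
    This gives 3 delta, and 3 <= 4 / (1 - nu). *)
Lemma quantile_near (R : realType) (X : normedModType R)
    (u : {linear X -> R^o}) (k : nat) (x : 'I_k -> X) (theta y : X) (delta : R)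
    (B : {set 'I_k}) :
  continuous u -> dual_norm u < 1 -> (0 < k)%N -> 0 <= delta ->
  4 * #|B|%:R <= (1 - dual_norm u) * k%:R ->
  (forall i, i \notin B -> `|x i - theta| <= delta) ->
  quantile_value u x y -> (1 - dual_norm u) * `|y - theta| <= 4 * delta.
Proof.
move=> u_continuous u_lt1 k_gt0 delta_ge0 B_small x_near [generic special].
have [] := pselect (exceptional_norms k (dual_norm u) /\ on_straight_line x);
  last by move=> /generic; exact: (geometric_quantile_near _ _ _ _ B_small).
move=> /special[z [h [t [[h1 xE] yE]]]].
have := normr_le_dual_norm h u_continuous.
rewrite h1 mulr1 => uh; have nu_ge0 := le_trans (normr_ge0 _) uh.
move: uh; rewrite ler_norml => /andP[uh1 uh2].
have K0 : 0 < k%:R :> R by rewrite ltr0n.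
have b0 : 0 <= #|B|%:R :> R by [].
have Bk : (#|B| < k)%N by rewrite -(ltr_nat R); nra.
have /existsP[g gB] : [exists g, g \notin B].
  apply: contraTT Bk => /existsPn BT; rewrite -leqNgt.
  rewrite -[leqLHS]card_ord subset_leq_card//.
  by apply/fintype.subsetP => i _; have := BT i; rewrite negbK.
have t_near i : i \notin B -> t g - 2 * delta <= t i <= t g + 2 * delta.
  move=> iB; rewrite -ler_distl.
  have -> : `|t i - t g| = `|x i - x g|.
    by rewrite !xE opprD addrACA subrr add0r -scalerBl normrZ h1 mulr1.
  have := x_near i iB; have := x_near g gB; have := ler_distD theta (x i) (x g).
  by rewrite [`|theta - _|]distrC; lra.
have : `|y - x g| <= 2 * delta.
  rewrite yE xE opprD addrACA subrr add0r -scalerBl normrZ h1 mulr1 ler_distl.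
  by apply: (univariate_quantile_between _ _ t_near); nra.
have := x_near g gB; have := ler_distD (x g) y theta.
nra.
Qed.

(** * The law of a block of an iid sample *)

Definition rectangles d (E : measurableType d) (m : nat) :
    set (set (m.-tuple E)) :=
  [set B | exists2 A : 'I_m -> set E, (forall i, measurable (A i)) &
     B = [set t | forall i, A i (tnth t i)]].

Lemma rectangles_setI d (E : measurableType d) (m : nat) :
  setI_closed (@rectangles d E m).
Proof.
move=> _ _ [A mA ->] [A' mA' ->]; exists (fun i => A i `&` A' i).
  by move=> i; exact: measurableI.
by apply/seteqP; split=> [t [tA tA'] i|t tAA']; split => // i; have [] := tAA' i.
Qed.

Lemma measurable_rectangles d (E : measurableType d) (m : nat) :
  measurable = <<s @rectangles d E m >>.
Proof.
apply/seteqP; split.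
  apply: smallest_sub; first exact: smallest_sigma_algebra.
  apply: (@subset_trans _ (@rectangles d E m)); last exact: sub_gen_smallest.
  rewrite -bigcup_seq; apply: bigcup_sub => i _ _ [A mA <-].
  exists (fun j => if j == i then A else setT).
    by move=> j; case: ifPn.
  rewrite setTI; apply/seteqP; split=> [t tA j|t /(_ i)].
    by case: eqP => // ->.
  by rewrite eqxx.
apply: smallest_sub; first exact: sigma_algebra_measurable.
move=> _ [A mA ->].
rewrite [X in measurable X](_ : _ =
    \bigcap_(i in [set: 'I_m]) ((@tnth m E)^~ i @^-1` A i)).
  apply: fin_bigcap_measurable => // i _.
  by rewrite -[X in measurable X]setTI; exact: measurable_tnth.
by apply/seteqP; split=> t tA i => [_|]; apply: tA.
Qed.

(** Independence determines the law on rectangles, which are stable under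
    intersection and generate the product sigma-algebra. *)
Lemma iid_law_unique d (Omega : measurableType d) (R : realType)
    (P : probability Omega R) dE (E : measurableType dE) (D : probability E R)
    (m : nat) (Y1 Y2 : {RV P >-> m.-tuple E}) :
  iid_sample P D Y1 -> iid_sample P D Y2 ->
  forall A, measurable A -> distribution P Y1 A = distribution P Y2 A.
Proof.
have law (Z : {RV P >-> m.-tuple E}) (A : 'I_m -> set E) : iid_sample P D Z ->
    (forall i, measurable (A i)) ->
    distribution P Z [set t | forall i, A i (tnth t i)] = (\prod_i D (A i))%E.
  move=> [marg indep] mA; have := indep [set: 'I_m]%SET A mA.
  rewrite (eq_bigl predT); last by move=> i; rewrite inE.
  rewrite (eq_bigr (fun i => D (A i))); last by move=> i _; exact: marg.
  move=> <-; rewrite /distribution /pushforward; congr (P _).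
  by apply/seteqP; split=> w wA i => [_|]; apply: wA.
move=> iid1 iid2 A mA.
apply: (measure_unique (@rectangles _ E m) (fun=> setT)) => //.
- exact: measurable_rectangles.
- exact: rectangles_setI.
- by move=> _; exists (fun=> setT) => //; apply/seteqP; split.
- by rewrite bigcup_const//; exists 0%N.
- by move=> _ [B mB ->]; exact: etrans (law _ _ iid1 mB) (esym (law _ _ iid2 mB)).
- move=> _.
  exact: le_lt_trans (probability_le1 (distribution P Y1) measurableT) (ltry _).
Qed.

Lemma iid_subsample d (Omega : measurableType d) (R : realType)
    (P : probability Omega R) dE (E : measurableType dE) (D : probability E R)
    (n m : nat) (Y : Omega -> n.-tuple E) (b : 'I_m -> 'I_n) :
  injective b -> iid_sample P D Y ->
  iid_sample P D (fun w => subsample (Y w) b).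
Proof.
move=> b_inj [marg indep]; split.
  move=> i A mA; rewrite -(marg (b i) A mA); congr (P _).
  by apply/seteqP; split=> w /=; rewrite tnth_mktuple.
move=> J A mA.
(* A' transports A along b; the coordinates outside the range of b are
   unconstrained. *)
pose A' i := if [pick j | b j == i] is Some j then A j else setT.
have A'b j : A' (b j) = A j.
  rewrite /A'; case: pickP => [j' /eqP/b_inj -> //|/(_ j)].
  by rewrite eqxx.
have mA' i : measurable (A' i) by rewrite /A'; case: pickP.
transitivity (P [set w | forall i, i \in b @: J -> A' i (tnth (Y w) i)]).
  congr (P _); apply/seteqP; split=> w /= wA i.
    by move=> /imsetP[j jJ ->]; rewrite A'b; have := wA j jJ; rewrite tnth_mktuple.
  by move=> iJ; have := wA _ (imset_f b iJ); rewrite A'b tnth_mktuple.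
rewrite indep// big_imset /=; last by move=> ? ? _ _; exact: b_inj.
apply: eq_bigr => i _; congr (P _).
by apply/seteqP; split=> w /=; rewrite A'b tnth_mktuple.
Qed.

Lemma measurable_subsample d (E : measurableType d) n m (b : 'I_m -> 'I_n) :
  measurable_fun [set: n.-tuple E] ((@subsample E n m)^~ b).
Proof.
apply/measurable_fun_tnthP => i.
rewrite (_ : _ \o _ = (@tnth n E)^~ (b i)); first exact: measurable_tnth.
by apply/funext => s /=; rewrite tnth_mktuple.
Qed.

Lemma probability_subsample d (Omega : measurableType d) (R : realType)
    (P : probability Omega R) dE (E : measurableType dE) (D : probability E R)
    (n m : nat) (Y : {RV P >-> n.-tuple E}) (Y' : {RV P >-> m.-tuple E})
    (b : 'I_m -> 'I_n) (A : set (m.-tuple E)) :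
  injective b -> iid_sample P D Y -> iid_sample P D Y' -> measurable A ->
  P [set w | A (subsample (Y w) b)] = distribution P Y' A.
Proof.
move=> b_inj iidY iidY' mA.
have mYb : measurable_fun setT ((@subsample E n m)^~ b \o Y).
  exact: measurableT_comp (measurable_subsample b) _.
pose Yb : {RV P >-> m.-tuple E} := mfun_Sub (mem_set mYb).
rewrite -(@iid_law_unique _ _ _ _ _ _ D _ Yb)//.
exact: iid_subsample.
Qed.

(** * Counting bad blocks *)

(** Markov's inequality for the random number of events that occur, whose
    expectation is the sum of their probabilities. *)
Lemma markov_count d (Omega : measurableType d) (R : realType)
    (P : probability Omega R) (k : nat) (F : 'I_k -> set Omega) (c : R) :
  (forall i, measurable (F i)) -> 0 < c ->
  (c%:E * mu_ext P [set w | c <= #|finset (fun i => w \in F i)|%:R]%R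
    <= \sum_i P (F i))%E.
Proof.
move=> mF c0.
pose g w : \bar R := (\sum_i (\1_(F i) w)%:E)%E.
have gE w : g w = (#|finset (fun i => w \in F i)|%:R)%:E.
  rewrite /g sumEFin; congr EFin.
  rewrite -sum1_card natr_sum [RHS]big_mkcond /=.
  by apply: eq_bigr => i _; rewrite indicE inE; case: ifP.
have mg : measurable_fun setT (g : Omega -> \bar R).
  apply: emeasurable_sum => i; apply/measurable_EFinP.
  exact: measurable_indic.
have -> : [set w | c <= #|finset (fun i => w \in F i)|%:R] =
    setT `&` [set w | (c%:E <= `|g w|)%E].
  by rewrite setTI; apply/seteqP; split=> w /=; rewrite gE lee_fin normr_nat.
rewrite measurable_mu_extE; last first.
  by apply: emeasurable_fun_c_infty => //; exact: measurableT_comp.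
apply: le_trans (le_integral_comp_abse P measurableT (f := id) _ _ _ mg c0) _ => //.
rewrite (eq_integral g); last by move=> w _; rewrite gE /= normr_nat.
rewrite ge0_integral_sum//; last first.
  by move=> i; apply/measurable_EFinP; exact: measurable_indic.
by apply: lee_sum => i _; rewrite integral_indic// setIT.
Qed.

(** Choosing in each hit block a position of S is injective, the blocks being
    disjoint. *)
Lemma contaminated_blocks n k m (b : 'I_k -> 'I_m -> 'I_n) (S : {set 'I_n}) :
  disjoint_blocks b ->
  (#|finset (fun i => [exists j, b i j \in S])| <= #|S|)%N.
Proof.
move=> b_inj; pose g (p : 'I_k * 'I_m) := b p.1 p.2.
have -> : finset (fun i => [exists j, b i j \in S]) = fst @: (g @^-1: S).
  apply/setP => i; rewrite inE; apply/existsP/imsetP => [[j ijS]|[[i' j]]].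
    by exists (i, j); rewrite // inE.
  by rewrite inE => ijS /= ->; exists j.
rewrite (leq_trans (leq_imset_card _ _))//.
rewrite -(card_imset _ b_inj) subset_leq_card//.
by apply/fintype.subsetP => _ /imsetP[p + ->]; rewrite inE.
Qed.

(** * Deviation bound and limit *)

(** The values are unique only almost surely: the bad set adds, to the data on
    which est is far from theta, a measurable null set carrying the ambiguity. *)
Lemma estimator_bad_set (R : realType) (X : normedModType R) (theta : X)
    d (Omega : measurableType d) (P : probability Omega R)
    dE (E : measurableType dE) (m : nat) (Y : {RV P >-> m.-tuple E})
    (est : m.-tuple E -> X) (values : m.-tuple E -> set X) (delta : R) :
  measurable_fun [set: m.-tuple E] (est : m.-tuple E -> borel X) ->
  {ae distribution P Y, forall t, values t = [set est t]} ->
  exists bad : set (m.-tuple E),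
    [/\ measurable bad,
        distribution P Y bad = mu_ext P [set w | delta < `|est (Y w) - theta|] &
        forall t z, ~ bad t -> values t z -> `|z - theta| <= delta].
Proof.
move=> mest [N [mN N0 valuesN]].
pose far := [set t : m.-tuple E | delta < `|est t - theta|].
have mfar : measurable far.
  rewrite [X in measurable X](_ : _ =
      setT `&` est @^-1` [set x | delta < `|x - theta|]).
    apply: mest => //; apply: sub_gen_smallest => /=.
    apply: (@open_comp _ _ (fun x : X => `|x - theta|) [set r | delta < r]).
      move=> x _; apply: cvg_norm; apply: cvgB; [exact: cvg_id|exact: cvg_cst].
    exact: open_gt.
  by rewrite setTI.
exists (N `|` far); split; first exact: measurableU.
- rewrite (_ : mu_ext P _ = distribution P Y far).
    by rewrite setUC measureU0.
  rewrite measurable_mu_extE// -[X in measurable X]setTI.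
  by rewrite [X in _ `&` X](_ : _ = Y @^-1` far)//; exact: measurable_funPT.
move=> t z /not_orP[Nt fart] tz.
have vt : values t = [set est t] by apply: contrapT => /valuesN.
by move: tz; rewrite vt => /= ->; rewrite leNgt; exact/negP.
Qed.

(** The admissible fraction (1 - nu) / 4 of bad blocks is shared equally between
    contaminated blocks and blocks whose clean estimate is bad; the factor
    8 / (1 - nu) is the inverse of the second half. *)
Lemma quantile_deviation_le (R : realType) (X : normedModType R) (theta : X)
  (u : {linear X -> R^o}) (q : forall k, ('I_k -> X) -> X)
  d (Omega : measurableType d) (P : probability Omega R)
  dE (E : measurableType dE) (D : probability E R)
  (n m k l : nat) (Y W : {RV P >-> n.-tuple E}) (Ym : {RV P >-> m.-tuple E})
  (est : m.-tuple E -> X) (values : m.-tuple E -> set X)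
  (b : 'I_k -> 'I_m -> 'I_n) (Z : 'I_k -> Omega -> X) (eps : R) :
  continuous u -> dual_norm u < 1 -> quantile_map u q ->
  iid_sample P D Y -> iid_sample P D Ym ->
  measurable_fun [set: m.-tuple E] (est : m.-tuple E -> borel X) ->
  {ae distribution P Ym, forall t, values t = [set est t]} ->
  contaminated l Y W -> disjoint_blocks b ->
  (forall i w, values (subsample (W w) (b i)) (Z i w)) ->
  (0 < k)%N -> 0 < eps ->
  8 * l%:R <= (1 - dual_norm u) * k%:R ->
  (mu_ext P [set w | (eps < `|q k (fun i => Z i w) - theta|)%R] <=
    (8 / (1 - dual_norm u))%:E *
    mu_ext P [set w | ((1 - dual_norm u) * eps / 4 < `|est (Ym w) - theta|)%R])%E.
Proof.
move=> u_continuous u_lt1 qu iidY iidYm mest values_ae [S SW] b_inj ZW k0 eps0 lk.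
set delta := (1 - dual_norm u) * eps / 4.
have [bad [mbad Pbad bad_near]] := estimator_bad_set theta delta mest values_ae.
pose F i : set Omega := [set w | bad (subsample (Y w) (b i))].
have mF i : measurable (F i).
  rewrite -[X in measurable X]setTI.
  have mYb : measurable_fun setT ((@subsample E n m)^~ (b i) \o Y).
    exact: measurableT_comp (measurable_subsample (b i)) _.
  exact: mYb.
have PF i : P (F i) = distribution P Ym bad.
  apply: probability_subsample iidY iidYm mbad.
  by move=> j j' bjj'; have [] := b_inj (i, j) (i, j') bjj'.
pose c : R := (1 - dual_norm u) * k%:R / 8.
have k0R : 0 < k%:R :> R by rewrite ltr0n.
have c0 : 0 < c by rewrite divr_gt0// mulr_gt0// subr_gt0.
have dev : [set w | eps < `|q k (fun i => Z i w) - theta|] `<=`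
    [set w | c <= #|finset (fun i => w \in F i)|%:R].
  move=> w /=; apply: contraPP => /negP; rewrite -ltNge => Fc.
  apply/negP; rewrite -leNgt.
  have [Sl SWY] := SW w.
  pose B := finset (fun i => w \in F i) :|:
            finset (fun i => [exists j, b i j \in S w]).
  have B_small : 4 * #|B|%:R <= (1 - dual_norm u) * k%:R.
    have : #|B|%:R <= #|finset (fun i => w \in F i)|%:R + l%:R :> R.
      rewrite -natrD ler_nat (leq_trans (leq_card_setU _ _))// leq_add2l.
      exact: leq_trans (contaminated_blocks _ b_inj) Sl.
    by move: Fc; rewrite /c; lra.
  have near i : i \notin B -> `|Z i w - theta| <= delta.
    rewrite !inE negb_or => /andP[/negP iF /existsPn iS].
    apply: bad_near (ZW i w).
    rewrite (_ : subsample (W w) (b i) = subsample (Y w) (b i)).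
      by move=> ?; apply: iF; rewrite inE.
    by apply: eq_from_tnth => j; rewrite !tnth_mktuple SWY.
  have delta0 : 0 <= delta by rewrite ltW// divr_gt0// mulr_gt0// subr_gt0.
  have := quantile_near u_continuous u_lt1 k0 delta0 B_small near (qu k _ k0).
  rewrite /delta [4 * _]mulrC divfK// ler_pM2l// subr_gt0//.
apply: le_trans (le_mu_ext P dev) _.
have := markov_count P mF c0.
rewrite (eq_bigr (fun=> distribution P Ym bad)); last by move=> i _; exact: PF.
rewrite sumr_const card_ord Pbad.
have -> : (8 / (1 - dual_norm u) = c^-1 * k%:R)%R.
  by rewrite /c; field; rewrite !gt_eqF ?subr_gt0.
move=> markov; rewrite EFinM -muleA lee_pdivlMl//.
by apply: le_trans markov _; rewrite mule_natl.
Qed.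

Lemma cvg_block_size (R : realType) (k : nat -> nat) :
  (forall n, (0 < k n)%N) ->
  (fun n => (k n)%:R : R^o) =o_\oo (fun n => n%:R : R^o) ->
  (n %/ k n)%N @[n --> \oo] --> \oo.
Proof.
move=> k_gt0 /eqoP k_small; apply/cvgnyPge => M.
(* M.+1 keeps the inverse positive when M is 0. *)
have := k_small (M.+1%:R^-1) _; rewrite invr_gt0 ltr0n => /(_ isT).
apply: filterS => n; rewrite !normr_nat ler_pdivlMl ?ltr0n//.
rewrite -natrM ler_nat => kn; rewrite leq_divRL//.
by apply: leq_trans kn; rewrite leq_mul.
Qed.

Theorem proposition3p24
  (R : realType) (X : completeNormedModType R)
  (X_reflexive : reflexive_space X)
  (theta0 : X)
  (u : {linear X -> R^o}) (u_continuous : continuous u)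
  (u_lt1 : dual_norm u < 1)
  (q : forall k : nat, ('I_k -> X) -> X) (q_quantile : quantile_map u q)
  (d : measure_display) (Omega : measurableType d) (P : probability Omega R)
  (dE : measure_display) (E : measurableType dE) (D : probability E R)
  (Y : forall n : nat, {RV P >-> n.-tuple E})
  (Y_iid : forall n, iid_sample P D (Y n))
  (* estimator: [values m t] are its possible values on the data [t];
     on uncontaminated data the only one is [est m t], almost surely *)
  (est : forall m : nat, m.-tuple E -> X)
  (est_measurable : forall m,
     measurable_fun [set: m.-tuple E] (est m : m.-tuple E -> borel X))
  (values : forall m : nat, m.-tuple E -> set X)
  (values_unique : forall m,
     {ae distribution P (Y m), forall t, values m t = [set est m t]})
  (est_cvg : cvg_in_probability P (fun m w => est m (Y m w)) theta0)
  (l k : nat -> nat) (k_gt0 : forall n, (0 < k n)%N)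
  (k_small : (fun n => (k n)%:R : R^o) =o_\oo (fun n => n%:R : R^o))
  (l_small : ((l n)%:R / (k n)%:R : R) @[n --> \oo] --> (0 : R))
  (W : forall n : nat, {RV P >-> n.-tuple E})
  (W_contaminated : forall n, contaminated (l n) (Y n) (W n))
  (block : forall n : nat, 'I_(k n) -> 'I_(n %/ k n) -> 'I_n)
  (block_disjoint : forall n, disjoint_blocks (block n))
  (Ztilde : forall n : nat, 'I_(k n) -> Omega -> X)
  (Ztilde_values : forall n (i : 'I_(k n)) w,
     values (n %/ k n)%N (subsample (W n w) (block n i)) (Ztilde n i w)) :
  cvg_in_probability P (fun n w => q (k n) (fun i => Ztilde n i w)) theta0.
Proof.
move=> eps eps0.
have nu_gt0 : 0 < 1 - dual_norm u by rewrite subr_gt0.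
pose delta := (1 - dual_norm u) * eps / 4.
have delta0 : 0 < delta by rewrite divr_gt0// mulr_gt0.
have := cvgeZl (y := (8 / (1 - dual_norm u))%:E) isT
  (cvg_comp _ _ (cvg_block_size k_gt0 k_small) (est_cvg _ delta0)).
rewrite mule0; apply: squeeze_cvge; last exact: cvg_cst.
have /cvgrPdist_le/(_ ((1 - dual_norm u) / 8) _) l_small' := l_small.
near=> n; rewrite mu_ext_ge0/=; last by move=> A; exact: measure_ge0.
apply: (quantile_deviation_le theta0 u_continuous u_lt1 q_quantile (Y_iid n)
  (Y_iid _) (est_measurable _) (values_unique _) (W_contaminated n)
  (block_disjoint n) (Ztilde_values n) (k_gt0 n) eps0 _).
have k0 : 0 < (k n)%:R :> R by rewrite ltr0n.
have : `|0 - (l n)%:R / (k n)%:R| <= (1 - dual_norm u) / 8 :> R.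
  by near: n; apply: l_small'; rewrite divr_gt0.
rewrite sub0r normrN ger0_norm ?divr_ge0// ler_pdivrMr//.
lra.
Unshelve. all: by end_near. Qed.
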